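(* Let $\mathbf{H}\in\mathbb{R}^{M\times N}$ be arbitrary, $\sigma>0$, $k\in[N]$, and consider observations $\mathbf{y}=\mathbf{H}\mathbf{x}+\mathbf{n}$ with $\mathbf{n}\sim\mathcal{N}(\mathbf{0},\sigma^2\mathbf{I})$ and parameter function $g(\mathbf{x})=x_k$. Let $\mathcal{X}\subseteq\mathbb{R}^N$ contain a nonempty open set, let $\mathbf{x}_0\in\mathcal{X}$, and let $c:\mathbb{R}^N\to\mathbb{R}$ be valid at $\mathbf{x}_0$ for the parameter set $\mathbb{R}^N$. Let $M_{\mathrm{LGM}}(c,\mathbf{x}_0)$ be the minimum achievable variance at $\mathbf{x}_0$ with bias prescribed as $c$ on $\mathbb{R}^N$, and $M'(c,\mathbf{x}_0)$ the minimum achievable variance at $\mathbf{x}_0$ with bias prescribed as $c$ on $\mathcal{X}$ only. Then $M'(c,\mathbf{x}_0)=M_{\mathrm{LGM}}(c,\mathbf{x}_0)$. Moreover, the LMV estimator at $\mathbf{x}_0$ for parameter set $\mathbb{R}^N$ and bias $c$ is also the LMV estimator at $\mathbf{x}_0$ for parameter set $\mathcal{X}$ and bias $c|_{\mathcal{X}}$.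
   Context: For a parameter set $\mathcal{Y}\subseteq\mathbb{R}^N$ containing $\mathbf{x}_0$ and bias function $c$ on $\mathcal{Y}$: an estimator $\hat g:\mathbb{R}^M\to\mathbb{R}$ is allowed if $v(\hat g;\mathbf{x}_0)=\mathsf{E}_{\mathbf{x}_0}\{(\hat g(\mathbf{y})-\mathsf{E}_{\mathbf{x}_0}\hat g(\mathbf{y}))^2\}<\infty$ and $\mathsf{E}_{\mathbf{x}}\{\hat g(\mathbf{y})\}-x_k=c(\mathbf{x})$ for all $\mathbf{x}\in\mathcal{Y}$; $c$ is valid at $\mathbf{x}_0$ if an allowed estimator exists; the minimum achievable variance is the infimum of $v(\hat g;\mathbf{x}_0)$ over allowed estimators ($+\infty$ if none), and an LMV estimator is an allowed estimator attaining it. *)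

(* Defs.v *)
From HB Require Import structures.
From mathcomp Require Import all_boot all_order all_algebra.
From mathcomp Require Import all_classical all_reals all_analysis.
Set Implicit Arguments. Unset Strict Implicit. Unset Printing Implicit Defensive.
Import Order.TTheory GRing.Theory Num.Theory.
Import numFieldTopology.Exports numFieldNormedType.Exports.
Local Open Scope classical_set_scope.
Local Open Scope ring_scope.

(* Linear Gaussian model  y = H x + n,  n ~ N(0, s^2 I_M).
   Parameters x live in 'cV[R]_N (with its matrix topology);
   observations y live in M.-tuple R (with the product = Borel sigma-algebra);
   the noise is a random vector n on an abstract probability space (T, P). *)

(* n is a measurable random vector whose coordinates are N(0, s^2)
   (normal_prob 0 s has standard deviation s) and mutually independent. *)
Definition gaussian_noise (R : realType) (M : nat) (d : measure_display)
    (T : measurableType d) (P : probability T R) (s : R)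
    (n : T -> M.-tuple R) : Prop :=
  [/\ measurable_fun [set: T] n,
      (forall (i : 'I_M) (B : set R), measurable B ->
         P ((fun w => tnth (n w) i) @^-1` B) = normal_prob 0 s B) &
      (forall B : 'I_M -> set R, (forall i, measurable (B i)) ->
         P (\bigcap_(i in [set: 'I_M]) ((fun w => tnth (n w) i) @^-1` B i))
         = (\prod_(i < M) P ((fun w => tnth (n w) i) @^-1` B i))%E)].

Definition lgm_obs (R : realType) (M N : nat) (H : 'M[R]_(M, N))
    (x : 'cV[R]_N) (v : M.-tuple R) : M.-tuple R :=
  [tuple (H *m x) i 0 + tnth v i | i < M].

Section LGM.
Context (R : realType) (M N : nat) (H : 'M[R]_(M, N)) (k : 'I_N)
  (d : measure_display) (T : measurableType d) (P : probability T R)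
  (n : T -> M.-tuple R).

Definition lgm_mean (g : M.-tuple R -> R) (x : 'cV[R]_N) : \bar R :=
  (\int[P]_w (g (lgm_obs H x (n w)))%:E)%E.

Definition lgm_var (g : M.-tuple R -> R) (x0 : 'cV[R]_N) : \bar R :=
  (\int[P]_w ((g (lgm_obs H x0 (n w)) - fine (lgm_mean g x0)) ^+ 2)%:E)%E.

Definition lgm_allowed (Y : set 'cV[R]_N) (c : 'cV[R]_N -> R)
    (x0 : 'cV[R]_N) (g : M.-tuple R -> R) : Prop :=
  [/\ measurable_fun [set: M.-tuple R] g,
      (forall x, Y x -> P.-integrable [set: T]
                         (fun w => (g (lgm_obs H x (n w)))%:E)),
      (lgm_var g x0 < +oo)%E &
      (forall x, Y x -> lgm_mean g x = (x k 0 + c x)%:E)].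

Definition lgm_valid (Y : set 'cV[R]_N) (c : 'cV[R]_N -> R) (x0 : 'cV[R]_N) :=
  exists g, lgm_allowed Y c x0 g.

(* minimum achievable variance (+oo if no allowed estimator) *)
Definition lgm_minvar (Y : set 'cV[R]_N) (c : 'cV[R]_N -> R)
    (x0 : 'cV[R]_N) : \bar R :=
  ereal_inf [set v | exists g, lgm_allowed Y c x0 g /\ v = lgm_var g x0].

Definition lgm_LMV (Y : set 'cV[R]_N) (c : 'cV[R]_N -> R) (x0 : 'cV[R]_N)
    (g : M.-tuple R -> R) : Prop :=
  lgm_allowed Y c x0 g /\ lgm_var g x0 = lgm_minvar Y c x0.

End LGM.

(* Main.v *)
Require Import Defs.
From HB Require Import structures.
From mathcomp Require Import all_boot all_order all_algebra.
From mathcomp Require Import all_classical all_reals all_analysis.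
From mathcomp Require Import measurable_realfun ring lra.
Set Implicit Arguments. Unset Strict Implicit. Unset Printing Implicit Defensive.
Import Order.TTheory GRing.Theory Num.Theory.
Import numFieldTopology.Exports numFieldNormedType.Exports.
Local Open Scope classical_set_scope.
Local Open Scope ring_scope.

(** Let [h] be square integrable for the law of the observation at [x0].  By the
    Gaussian translation formula, the mean of [h] at [x] is
      E[h(H x0 + n) exp(<w, n> / s^2 - |w|^2 / (2 s^2))]  with  w = H (x - x0),
    which exists for every [x] since the exponential factor is square integrable.
    Along a line [x1 + t (x - x1)] it is, up to a positive factor depending on
    [t], of the form E[W exp(t Z)], a power series in [t] converging everywhere;
    so a mean that vanishes on an open set vanishes identically.  Applied to
    the difference of two estimators, this shows that the same estimators are
    allowed for [X] and for the whole space. *)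

(** * Power series vanishing to the right of the origin *)

(** Strong induction on [k]: once the lower coefficients vanish, dividing the series by [t ^+ k]
    leaves [a k] plus a remainder of order [t], and [t] can be arbitrarily small. *)
Lemma power_series_eq0 (R : realType) (a : R^nat) (e : R) : 0 < e ->
  (forall t : R, 0 < t < e -> series (fun k => a k * t ^+ k) @ \oo --> (0 : R)) ->
  forall k, a k = 0.
Proof.
move=> e0 cvg0.
pose r := e / 2.
have r0 : 0 < r by rewrite /r; lra.
have re : r < e by rewrite /r; lra.
have [C C0 aC] : exists2 C : R, 0 <= C & forall k, `|a k| * r ^+ k <= C.
  have /cvgP cr : series (fun k => a k * r ^+ k) @ \oo --> (0 : R).
    by apply: cvg0; rewrite r0.
  have /cvg_seq_bounded [C [_ HC]] := cvgP _ (cvg_series_cvg_0 cr).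
  (* [cvg_seq_bounded] bounds the sequence by every real strictly above [C], hence the [+ 1]. *)
  exists (`|C| + 1); first by rewrite addr_ge0.
  move=> k; have := HC (`|C| + 1) _ k I; rewrite /= normrM normrX (gtr0_norm r0).
  by apply; rewrite (le_lt_trans (ler_norm C))// ltrDl.
elim/ltn_ind => k IH.
(* For [t < r / 2] the terms past index [k] are dominated by a geometric series of ratio
   [q = t / r < 1 / 2], whose sum is at most twice its first term. *)
have tail (t : R) : 0 < t < r / 2 -> `|a k| * r ^+ k.+1 <= 2 * C * t.
  move=> /andP[t0 tr].
  have te : 0 < t < e by rewrite t0/=; lra.
  pose q : R := t / r.
  have q0 : 0 < q by rewrite divr_gt0.
  have q2 : q < 2^-1 by rewrite ltr_pdivrMr//; lra.
  have tq : t = q * r by rewrite /q divfK// gt_eqF.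
  have bnd m : `|series (fun k => a k * t ^+ k) (k.+1 + m)%N - a k * t ^+ k|
      <= 2 * C * q ^+ k.+1.
    rewrite /series/= (@big_cat_nat _ _ _ k.+1)//= ?leq_addr//.
    rewrite big_nat_recr//= big_nat big1 ?add0r; last first.
      by move=> i /andP[_ ik]; rewrite IH// mul0r.
    rewrite addrAC subrr add0r.
    apply: le_trans (ler_norm_sum _ _ _) _.
    apply: (@le_trans _ _ (\sum_(k.+1 <= i < k.+1 + m) C * q ^+ i)).
      apply: ler_sum => i _; rewrite normrM normrX (gtr0_norm t0) tq exprMn.
      rewrite (mulrC (q ^+ i)) mulrA; apply: ler_wpM2r => //.
      by rewrite exprn_ge0// ltW.
    rewrite -big_distrr/= geometric_partial_tail geometric_seriesE; last first.
      by rewrite lt_eqF//; lra.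
    rewrite /= -(mulrA (q ^+ _)) (mulrA C) (mulrC 2) (mulrAC C).
    apply: ler_wpM2r; first by rewrite exprn_ge0// ltW.
    apply: ler_wpM2l => //.
    rewrite ler_pdivrMr; last lra.
    have : 0 <= q ^+ m by rewrite exprn_ge0// ltW.
    lra.
  have : `|0 - a k * t ^+ k| <= 2 * C * q ^+ k.+1.
    have cv : `|series (fun k => a k * t ^+ k) (m + k.+1)%N - a k * t ^+ k|
       @[m --> \oo] --> `|0 - a k * t ^+ k|.
      apply: cvg_norm; apply: cvgB; last exact: cvg_cst.
      by rewrite (cvg_shiftn k.+1 (series _)); exact: cvg0.
    rewrite -(cvg_lim _ cv)//; apply: limr_le; first exact: cvgP cv.
    by near=> m; rewrite addnC; exact: bnd.
  rewrite sub0r normrN normrM normrX (gtr0_norm t0) => H.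
  have : `|a k| * t ^+ k * r ^+ k.+1 <= 2 * C * t ^+ k.+1.
    apply: le_trans (ler_wpM2r _ H) _; first by rewrite exprn_ge0// ltW.
    by rewrite -(mulrA (2 * C)) -exprMn -tq.
  by rewrite mulrAC (exprS t) (mulrA (2 * C)) ler_pM2r ?exprn_gt0//.
apply/eqP; rewrite -normr_eq0; apply/eqP/le_anti; rewrite normr_ge0 andbT.
rewrite leNgt; apply/negP => ak0.
have c0 : 0 < `|a k| * r ^+ k.+1 by rewrite mulr_gt0// exprn_gt0.
set c := `|a k| * r ^+ k.+1 in c0 tail.
(* [r / 4] keeps [t] in the range of [tail]; the other bound gives [4 * (C + 1) * t <= c], against
   [c <= 2 * C * t]. Using [C + 1] keeps the denominator positive when [C = 0]. *)
pose t := Num.min (r / 4) (c / (4 * (C + 1))).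
have t0 : 0 < t by rewrite lt_min !divr_gt0//; lra.
have tr : t <= r / 4 by rewrite ge_min lexx.
have tc : t * (4 * (C + 1)) <= c.
  by rewrite -ler_pdivlMr; [rewrite ge_min lexx orbT|lra].
have := tail t; rewrite t0 => /(_ ltac:(lra)).
nra.
Unshelve. all: by end_near. Qed.

Lemma exp_coeff_le_expR (R : realType) (y : R) (n : nat) : 0 <= y ->
  series (exp_coeff y) n <= expR y.
Proof.
move=> y0; apply: nondecreasing_cvgn_le; last exact: is_cvg_series_exp_coeff.
apply/nondecreasing_seqP => m; rewrite seriesSr lerDl.
by rewrite exp_coeff_ge0.
Qed.

(** * Integrals of [W exp(t Z)] as power series in [t] *)

Section exponential_moments.
Context (d : measure_display) (T : measurableType d) (R : realType).
Variables (P : {measure set T -> \bar R}) (W Z : T -> R).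
Hypotheses (mW : measurable_fun [set: T] W) (mZ : measurable_fun [set: T] Z).
Hypothesis intWZ :
  forall t, P.-integrable [set: T] (fun x => (W x * expR (t * Z x))%:E).

(** Since exp |u| <= exp u + exp (- u), the hypothesis at [t] and at [- t] suffices. This is the
    dominating function for the exponential series. *)
Lemma integrable_expR_abs t :
  P.-integrable [set: T] (fun x => (`|W x| * expR `|t * Z x|)%:E).
Proof.
have mE u : measurable_fun [set: T] (fun x => expR (u * Z x)).
  by apply: measurableT_comp => //; exact: measurable_funM.
apply: (@le_integrable _ _ _ _ _ _ _
    (fun x => `|(W x * expR (t * Z x))%:E| + `|(W x * expR (- t * Z x))%:E|)%E).
- by [].
- apply/measurable_EFinP; apply: measurable_funM.
    exact: measurableT_comp.
  apply: measurableT_comp => //; apply: measurableT_comp => //.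
  exact: measurable_funM.
- move=> x _ /=; rewrite lee_fin !normrM !normr_id.
  rewrite [leRHS]ger0_norm; last by rewrite addr_ge0// mulr_ge0.
  rewrite -mulrDr ler_wpM2l// !(ger0_norm (expR_ge0 _))// mulNr -normrM.
  have [tz|tz] := leP 0 (t * Z x).
    by rewrite ger0_norm// lerDl expR_ge0.
  by rewrite ltr0_norm// lerDr expR_ge0.
- by apply: integrableD => //; apply: integrable_abse; exact: intWZ.
Qed.

Let mom k : \bar R := (\int[P]_x (W x * (Z x ^+ k / k`!%:R))%:E)%E.

Let mterm t k : measurable_fun [set: T] (fun x => W x * exp_coeff (t * Z x) k).
Proof.
apply: measurable_funM => //; rewrite /exp_coeff/=.
by apply: measurable_funM => //; apply: measurable_funX; exact: measurable_funM.
Qed.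

Let intterm t k :
  P.-integrable [set: T] (fun x => (W x * exp_coeff (t * Z x) k)%:E).
Proof.
apply: le_integrable (integrable_expR_abs t) => //.
  exact/measurable_EFinP.
move=> x _ /=; rewrite lee_fin normrM [leRHS]normrM normr_id ler_wpM2l//.
rewrite [leRHS]ger0_norm ?expR_ge0//.
have -> : `|exp_coeff (t * Z x) k| = exp_coeff `|t * Z x| k.
  by rewrite /exp_coeff/= normrM normfV normrX (@ger0_norm _ k`!%:R).
(* A nonnegative term is at most the partial sum ending with it, which has index [k.+1] because
   [series] stops before its index. *)
apply: le_trans (exp_coeff_le_expR k.+1 _); last by [].
rewrite seriesSr lerDr /series/=; apply: sumr_ge0 => i _.
by rewrite exp_coeff_ge0.
Qed.

Let intmom k : P.-integrable [set: T] (fun x => (W x * (Z x ^+ k / k`!%:R))%:E).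
Proof.
have := intterm 1 k; congr (integrable _ _ _).
by apply/funext => x; rewrite /exp_coeff/= mul1r.
Qed.

(** Dominated convergence exchanges the integral with the exponential series of [t * Z x]. *)
Lemma cvg_exponential_moments t :
  series (fun k => fine (mom k) * t ^+ k) @ \oo -->
  fine (\int[P]_x (W x * expR (t * Z x))%:E)%E.
Proof.
have dom : (\int[P]_x (W x * series (exp_coeff (t * Z x)) n)%:E)%E @[n --> \oo]
    --> (\int[P]_x (W x * expR (t * Z x))%:E)%E.
  apply: (@dominated_cvg _ _ _ _ _ _ _ _
    (fun x => (`|W x| * expR `|t * Z x|)%:E)) => //.
  - move=> n; apply/measurable_EFinP.
    under eq_fun do rewrite /series/= mulr_sumr.
    by apply: measurable_sum => i; exact: mterm.
  - move=> x _; apply: cvg_EFin; first by near=> n.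
    apply: cvgM; first exact: cvg_cst.
    exact: is_cvg_series_exp_coeff.
  - exact: integrable_expR_abs.
  - move=> n x _; rewrite lee_fin normrM ler_wpM2l//.
    apply: le_trans (exp_coeff_le_expR n (normr_ge0 _)).
    by rewrite -normed_series_exp_coeff /=; exact: ler_norm_sum.
have -> : series (fun k => fine (mom k) * t ^+ k) =
  fine \o (fun n => (\int[P]_x (W x * series (exp_coeff (t * Z x)) n)%:E)%E).
  apply/funext => n /=.
  under eq_integral do rewrite /series/= mulr_sumr -sumEFin.
  rewrite integral_sum//.
  rewrite -sum_fine; last by move=> i _; exact: integrable_fin_num.
  apply: eq_bigr => k _.
  have -> : (\int[P]_x (W x * exp_coeff (t * Z x) k)%:E = (t ^+ k)%:E * mom k)%E.
    rewrite -integralZl//; apply: eq_integral => x _.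
    by rewrite -EFinM /exp_coeff/= exprMn; congr EFin; ring.
  have : mom k \is a fin_num by apply: integrable_fin_num => //; exact: intmom.
  by case: (mom k) => [m| |]// _; rewrite -EFinM/= mulrC.
apply: fine_cvg; rewrite fineK//.
exact: integrable_fin_num.
Unshelve. all: by end_near. Qed.

Lemma exponential_integral_eq0 (e : R) : 0 < e ->
  (forall t : R, 0 < t < e -> (\int[P]_x (W x * expR (t * Z x))%:E = 0)%E) ->
  forall t, (\int[P]_x (W x * expR (t * Z x))%:E = 0)%E.
Proof.
move=> e0 near0 t.
have mom0 : forall k, fine (mom k) = 0.
  apply: (@power_series_eq0 _ (fine \o mom) e) => // u ue.
  by have := @cvg_exponential_moments u; rewrite near0.
have := @cvg_exponential_moments t.
under eq_fun do rewrite mom0 mul0r.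
move=> ct; have c0 : series (fun=> (0 : R)) @ \oo --> (0 : R).
  rewrite (_ : series _ = cst 0); first exact: cvg_cst.
  by apply/funext => n; rewrite /series/= big1.
have E := cvg_unique _ ct c0.
by rewrite -[LHS]fineK ?E//; exact: integrable_fin_num.
Qed.

End exponential_moments.

(** * Integration against a measure given by a density *)

Section density.
Context (d : measure_display) (T : measurableType d) (R : realType).
Variables (mu : {measure set T -> \bar R}) (rho : T -> R).
Hypotheses (mrho : measurable_fun [set: T] rho) (rho0 : forall x, 0 <= rho x).

Lemma density_measure : exists nu : {measure set T -> \bar R},
  forall A, nu A = (\int[mu]_(x in A) (rho x)%:E)%E.
Proof.
pose nu A := (\int[mu]_(x in A) (rho x)%:E)%E.
have nu0 : nu set0 = 0%E by rewrite /nu integral_set0.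
have nu_ge0 A : (0 <= nu A)%E.
  by apply: integral_ge0 => x _; rewrite lee_fin.
have nu_sigma : semi_sigma_additive nu.
  move=> /= F mF tF mUF; rewrite /nu ge0_integral_bigcup//; first last.
  - by move=> x _; rewrite lee_fin.
  - by apply: measurable_funTS; exact/measurable_EFinP.
  apply: is_cvg_ereal_nneg_natsum_cond => n _ _.
  by apply: integral_ge0 => x _; rewrite lee_fin.
pose nuM : {measure set T -> \bar R} :=
  HB.pack nu (isMeasure.Build _ _ _ nu nu0 nu_ge0 nu_sigma).
by exists nuM.
Qed.

Variable nu : {measure set T -> \bar R}.
Hypothesis nuE :
  forall A, measurable A -> nu A = (\int[mu]_(x in A) (rho x)%:E)%E.

Import HBNNSimple.

(** Indicators are covered by [nuE], simple functions by linearity, the rest by monotone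
    convergence. Assuming only [nuE] lets the lemma serve for normal laws, restricted measures and
    reweighted probabilities alike. *)
Lemma ge0_integral_density (D : set T) (f : T -> \bar R) :
  measurable D -> measurable_fun D f -> (forall x, D x -> 0 <= f x)%E ->
  (\int[nu]_(x in D) f x = \int[mu]_(x in D) (f x * (rho x)%:E))%E.
Proof.
move=> mD mf f0; pose h := nnsfun_approx mD mf.
have mErho : measurable_fun [set: T] (EFin \o rho) by exact/measurable_EFinP.
have -> : (\int[nu]_(x in D) f x =
    limn (fun n => \int[nu]_(x in D) (h n x)%:E))%E.
  rewrite -monotone_convergence//.
  - apply: eq_integral => x /[!inE] xD; apply/esym/cvg_lim => //.
    exact: cvg_nnsfun_approx.
  - by move=> n; apply/measurable_EFinP; exact: measurable_funTS.
  - by move=> n x _; rewrite lee_fin.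
  - by move=> x _ a b ab; rewrite lee_fin; exact/lefP/nd_nnsfun_approx.
have -> : (\int[mu]_(x in D) (f x * (rho x)%:E) =
    limn (fun n => \int[mu]_(x in D) ((h n x)%:E * (rho x)%:E)))%E.
  rewrite -monotone_convergence//.
  - apply: eq_integral => x /[!inE] xD; apply/esym/cvg_lim => //.
    by apply: cvgeZr => //; exact: cvg_nnsfun_approx.
  - move=> n; apply: emeasurable_funM; last exact: measurable_funTS.
    by apply/measurable_EFinP; exact: measurable_funTS.
  - by move=> n x _; rewrite mule_ge0 ?lee_fin.
  - move=> x _ a b ab; rewrite lee_wpmul2r ?lee_fin//.
    exact/lefP/nd_nnsfun_approx.
congr (limn _); apply/funext => n.
have mI r : measurable_fun D (fun x => (r * \1_(h n @^-1` [set r]) x)%:E).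
  by apply/measurable_EFinP; exact: measurable_funM.
transitivity (\int[nu]_(x in D)
   (\sum_(y \in range (h n)) (y * \1_(h n @^-1` [set y]) x)%:E))%E.
  by apply: eq_integral => t tE; rewrite /= fimfunE -fsumEFin.
rewrite ge0_integral_fsum//; last by move=> m y Ey; exact: nnfun_muleindic_ge0.
transitivity (\int[mu]_(x in D) (\sum_(y \in range (h n))
    ((y * \1_(h n @^-1` [set y]) x)%:E * (rho x)%:E)))%E; last first.
  apply: eq_integral => x xD.
  rewrite -ge0_mule_fsuml => [|y]; last exact: nnfun_muleindic_ge0.
  by rewrite fsumEFin// -(fimfunE _ x).
rewrite ge0_integral_fsum//; last 2 first.
  - by move=> y; apply: emeasurable_funM => //; exact: measurable_funTS.
  - by move=> m y Ey; rewrite mule_ge0 ?lee_fin// -lee_fin EFinM nnfun_muleindic_ge0.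
apply: eq_fsbigr => r rhn.
under eq_integral do rewrite EFinM.
rewrite integralZl_indic_nnsfun// integral_indic//.
under eq_integral do rewrite EFinM -muleA.
have r0 : 0 <= r by move: rhn; rewrite inE => -[x _ <-].
rewrite ge0_integralZl//; last 2 first.
- apply: emeasurable_funM; last exact: measurable_funTS.
  by apply/measurable_EFinP.
- by move=> x _; rewrite mule_ge0 ?lee_fin.
congr (_ * _)%E.
under eq_integral do rewrite muleC.
rewrite (eq_integral ((EFin \o rho) \_ (h n @^-1` [set r]))); last first.
  by move=> x _; rewrite epatch_indic.
rewrite -integral_mkcondr nuE; first by rewrite setIC.
exact: measurableI.
Qed.

End density.

(** * Translates of Lebesgue measure and of normal laws *)

Lemma lebesgue_measure_translation (R : realType) (w : R) (A : set R) :
  measurable A ->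
  lebesgue_measure ((fun x => w + x) @^-1` A) = lebesgue_measure A.
Proof.
move=> mA.
have mw : measurable_fun [set: R]
    ((fun x => w + x) : measurableTypeR R -> measurableTypeR R).
  exact: measurable_funD.
(* By uniqueness it is enough to compare the two measures on half-open intervals. *)
apply/esym; have := @lebesgue_measure_unique R
  (pushforward lebesgue_measure
    ((fun x => w + x) : measurableTypeR R -> measurableTypeR R)) _ A mA.
apply => _ [[a b]] _ <-.
transitivity (lebesgue_measure `]a - w, b - w]%classic).
  by rewrite !lebesgue_measure_itv/= !lte_fin ltrD2r -!EFinD opprB addrA subrK.
congr (lebesgue_measure _).
by apply/seteqP; split=> x; rewrite /= !in_itv/= ltrBlDl lerBrDl.
Qed.

Lemma normal_prob_translation (R : realType) (w s : R) (A : set R) :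
  s != 0 -> measurable A ->
  normal_prob 0 s ((fun x => w + x) @^-1` A) = normal_prob w s A.
Proof.
move=> s0 mA.
pose f : measurableTypeR R -> measurableTypeR R := fun x => w + x.
have mf : measurable_fun [set: R] f.
  exact: measurable_funD.
rewrite /normal_prob.
transitivity (\int[pushforward lebesgue_measure f]_(x in A)
    (normal_pdf w s x)%:E)%E.
  rewrite ge0_integral_pushforward//.
  - apply: eq_integral => x _; rewrite /= /f !normal_pdfE// /normal_fun.
    by rewrite subr0 (addrC w) addrK.
  - by apply/measurable_funTS/measurable_EFinP; exact: measurable_normal_pdf.
  - by move=> y _; rewrite lee_fin normal_pdf_ge0.
by apply: eq_measure_integral => B mB _; exact: lebesgue_measure_translation.
Qed.

(** * Boxes in the observation space *)

Section tuple_boxes.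
Context (R : realType) (M : nat).

Definition tuple_box (B : 'I_M -> set R) : set (M.-tuple R) :=
  [set v | forall i, B i (tnth v i)].

Lemma measurable_tuple_box (B : 'I_M -> set R) :
  (forall i, measurable (B i)) -> measurable (tuple_box B).
Proof.
move=> mB.
have -> : tuple_box B = \bigcap_(i in [set: 'I_M]) (@tnth M R ^~ i @^-1` B i).
  by apply/seteqP; split => [v Bv i _|v Bv i]; exact: Bv.
apply: fin_bigcap_measurable; first exact: finite_finset.
by move=> i _; rewrite -[X in measurable X]setTI; exact: measurable_tnth.
Qed.

(** Boxes are stable under intersection, include the whole space and generate the sigma-algebra, so
    uniqueness of finite measures on a pi-system applies. *)
Lemma eq_measure_tuple (m1 m2 : {measure set (M.-tuple R) -> \bar R}) :
  (m1 setT < +oo)%E ->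
  (forall B : 'I_M -> set R, (forall i, measurable (B i)) ->
    m1 (tuple_box B) = m2 (tuple_box B)) ->
  forall A, measurable A -> m1 A = m2 A.
Proof.
move=> m1oo m12 A mA.
pose G := [set tuple_box B | B in [set B | forall i, measurable (B i)]].
have boxT : tuple_box (fun=> setT) = setT by apply/seteqP.
apply: (measure_unique G (fun=> setT)) => //.
- apply/seteqP; split.
    apply: smallest_sub; first exact: smallest_sigma_algebra.
    rewrite -bigcup_seq/= => _ [i _ [C mC <-]].
    apply: sub_sigma_algebra.
    (* A generator of the product sigma-algebra constrains one coordinate only; the other sides of
       the box are full. *)
    exists (fun j => if j == i then C else setT).
      by move=> j; case: ifPn.
    rewrite setTI; apply/seteqP; split=> v /=; first by move/(_ i); rewrite eqxx.
    by move=> Cv j; case: eqP => // ->.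
  apply: smallest_sub; first exact: sigma_algebra_measurable.
  by move=> _ [B mB <-]; exact: measurable_tuple_box.
- move=> _ _ [B mB <-] [C mC <-]; exists (fun i => B i `&` C i).
    by move=> i; exact: measurableI.
  apply/seteqP; split=> [v BC|v [Bv Cv] i]; last by split.
  by split => i; case: (BC i).
- by move=> _; exists (fun=> setT).
- by rewrite bigcup_const//; exists 0%N.
- by move=> _ [B mB <-]; exact: m12.
Qed.

End tuple_boxes.

(** * Shifts and their Gaussian densities *)

Section gaussian_shift.
Context (R : realType) (M : nat).
Implicit Types (w : 'cV[R]_M) (v : M.-tuple R).

Definition tshift w v : M.-tuple R := [tuple w i 0 + tnth v i | i < M].

(** The density of N(w, s^2 I) with respect to N(0, s^2 I), that is exp(<w, v> / s^2 - |w|^2 / (2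
    s^2)). *)
Definition shift_density (s : R) w v : R :=
  expR (\sum_(i < M) (w i 0 * tnth v i / s ^+ 2 - w i 0 ^+ 2 / (s ^+ 2 *+ 2))).

Lemma tnth_tshift w v i : tnth (tshift w v) i = w i 0 + tnth v i.
Proof. by rewrite tnth_mktuple. Qed.

Lemma tshiftD w1 w2 v : tshift (w1 + w2) v = tshift w1 (tshift w2 v).
Proof. by apply: eq_from_tnth => i; rewrite !tnth_tshift mxE addrA. Qed.

Lemma tshift0 v : tshift 0 v = v.
Proof. by apply: eq_from_tnth => i; rewrite !tnth_tshift mxE add0r. Qed.

Lemma measurable_tshift w : measurable_fun [set: M.-tuple R] (tshift w).
Proof.
apply/measurable_fun_tnthP => i.
rewrite (_ : _ \o _ = fun v => w i 0 + tnth v i).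
  by apply: measurable_funD => //; exact: measurable_tnth.
by apply/funext => v /=; rewrite tnth_tshift.
Qed.

Lemma measurable_shift_density s w :
  measurable_fun [set: M.-tuple R] (shift_density s w).
Proof.
apply: measurableT_comp => //; apply: measurable_sum => i.
apply: measurable_funB => //; apply: measurable_funM => //.
by apply: measurable_funM => //; exact: measurable_tnth.
Qed.

Lemma shift_density_ge0 s w v : 0 <= shift_density s w v.
Proof. exact: expR_ge0. Qed.

Lemma shift_density0 s v : shift_density s 0 v = 1.
Proof.
rewrite /shift_density big1 ?expR0// => i _.
by rewrite mxE !mul0r expr0n/= mul0r subr0.
Qed.

(** Shifting the argument contributes an extra <w2, w1> / s^2, which cancels the cross term of |w1 +
    w2|^2 / (2 s^2). *)
Lemma shift_densityD s w1 w2 v : s != 0 ->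
  shift_density s (w1 + w2) (tshift w1 v) =
  shift_density s w1 (tshift w1 v) * shift_density s w2 v.
Proof.
move=> s0; rewrite -expRD -big_split/=; congr expR; apply: eq_bigr => i _.
by rewrite tnth_tshift mxE -mulr_natr; field.
Qed.

Lemma shift_density_delta s (a : R) i v :
  shift_density s (a *: delta_mx i 0) v =
  expR (a * tnth v i / s ^+ 2 - a ^+ 2 / (s ^+ 2 *+ 2)).
Proof.
congr expR; rewrite (bigD1 i)//= big1 ?addr0; last first.
  by move=> j /negPf ji; rewrite !mxE ji/= mulr0 !mul0r expr0n mul0r subr0.
by rewrite !mxE !eqxx mulr1.
Qed.

End gaussian_shift.

(** * Translation formula for Gaussian noise *)

Section gaussian_noise_translation.
Context (R : realType) (M : nat) (d : measure_display) (T : measurableType d).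
Variables (P : probability T R) (s : R) (n : T -> M.-tuple R).
Hypotheses (s0 : s != 0) (gn : gaussian_noise P s n).

Let mn : measurable_fun [set: T] n. Proof. by case: gn. Qed.

Let nM : {mfun T >-> M.-tuple R} := HB.pack n (isMeasurableFun.Build _ _ _ _ n mn).

Let mni i : measurable_fun [set: T] (fun x => tnth (n x) i).
Proof. exact: (measurableT_comp (measurable_tnth i) mn). Qed.

(* [normal_prob] is a measure on [measurableTypeR R], whose measurable sets are
   those of [R] but under another display; hence this cast. *)
Let ni i : T -> measurableTypeR R := fun x => tnth (n x) i.

Let mni' i : measurable_fun [set: T] (ni i). Proof. exact: mni. Qed.

Let niM i : {mfun T >-> measurableTypeR R} :=
  HB.pack (ni i) (isMeasurableFun.Build _ _ _ _ _ (mni' i)).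

Lemma noise_box (B : 'I_M -> set R) : (forall i, measurable (B i)) ->
  (P (n @^-1` tuple_box B) = \prod_(i < M) normal_prob 0 s (B i))%E.
Proof.
move=> mB; case: gn => _ law indep.
transitivity (P (\bigcap_(i in [set: 'I_M]) ((fun x => tnth (n x) i) @^-1` B i))).
  by congr (P _); apply/seteqP; split => [x Bx i _|x Bx i]; exact: Bx.
by rewrite indep//; apply: eq_bigr => i _; exact: law.
Qed.

Lemma shifted_noise_box w (B : 'I_M -> set R) : (forall i, measurable (B i)) ->
  (P ((tshift w \o n) @^-1` tuple_box B) =
   \prod_(i < M) normal_prob (w i 0%R) s (B i))%E.
Proof.
move=> mB; pose B' i := (fun y => w i 0 + y) @^-1` B i.
have mB' i : measurable (B' i).
  have mw : measurable_fun [set: R] (fun y => w i 0 + y).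
    exact: measurable_funD.
  by rewrite /B' -[X in measurable X]setTI; apply: mw => //; exact: mB.
transitivity (P (n @^-1` tuple_box B')).
  congr (P _); apply/seteqP; split=> x /= Bx i; have := Bx i.
    by rewrite tnth_tshift.
  by rewrite tnth_tshift.
rewrite noise_box; last exact: mB'.
apply: eq_bigr => i _; exact: (normal_prob_translation (w i 0) s0 (mB i)).
Qed.

Let density1 (a y : R) : R := expR (a * y / s ^+ 2 - a ^+ 2 / (s ^+ 2 *+ 2)).

Let mdensity1 a : measurable_fun [set: R] (density1 a).
Proof.
apply: measurableT_comp => //; apply: measurable_funB => //.
by apply: measurable_funM => //; exact: measurable_funM.
Qed.

(** Completing the square: the exponential factor times the density of N(0, s^2) is the density of
    N(a, s^2). *)
Lemma integral_normal_prob_density (a : R) (B : set R) : measurable B ->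
  (\int[normal_prob 0 s]_(y in B)
     (expR (a * y / s ^+ 2 - a ^+ 2 / (s ^+ 2 *+ 2)))%:E = normal_prob a s B)%E.
Proof.
move=> mB.
rewrite (@ge0_integral_density _ _ R lebesgue_measure (normal_pdf 0 s)
  (@measurable_normal_pdf R 0 s) (@normal_pdf_ge0 R 0 s) (normal_prob 0 s))//.
- apply: eq_integral => y _; rewrite -EFinM; congr EFin.
  rewrite !normal_pdfE// mulrCA /normal_fun -expRD; congr (_ * expR _).
  by rewrite -(mulr_natr (s ^+ 2)); field.
- by apply/measurable_funTS/measurable_EFinP; exact: mdensity1.
Qed.

(** The density involves coordinate [i] alone, and by independence the other coordinates contribute
    a constant factor, so the one-dimensional case applies. *)
Lemma integral_noise_box_delta (a : R) (i : 'I_M) (B : 'I_M -> set R) :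
  (forall j, measurable (B j)) ->
  (\int[P]_(x in n @^-1` tuple_box B)
     (shift_density s (a *: delta_mx i 0%R) (n x))%:E =
   normal_prob a s (B i) * \prod_(j < M | j != i) normal_prob 0 s (B j))%E.
Proof.
move=> mB.
pose upd (C : set R) j := if j == i then C else B j.
have mupd C : measurable C -> forall j, measurable (upd C j).
  by move=> mC j; rewrite /upd; case: ifPn.
have mpre (C : 'I_M -> set R) : (forall j, measurable (C j)) ->
    measurable (n @^-1` tuple_box C).
  move=> mC; rewrite -[X in measurable X]setTI.
  by apply: mn => //; exact: measurable_tuple_box.
(* [A] is the event that constrains every coordinate except [i]. *)
have mA := mpre _ (mupd _ (@measurableT _ R)).
set A := (X in measurable X) in mA.
have mniB : measurable (niM i @^-1` B i).
  by rewrite -[X in measurable X]setTI; exact: mni.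
have AB C : niM i @^-1` C `&` A = n @^-1` tuple_box (upd C).
  apply/seteqP; split=> [x [Cx Ax] j|x Cx].
    by have := Ax j; rewrite /upd; case: eqP => // ->.
  split; first by have := Cx i; rewrite /upd eqxx.
  by move=> j; have := Cx j; rewrite /upd; case: eqP.
set q := (\prod_(j < M | j != i) _)%E.
have q0 : (0 <= q)%E by apply: prode_ge0 => j _; exact: measure_ge0.
have qfin : q \is a fin_num.
  rewrite /q; apply: prode_fin_num => j _.
  exact: (fin_num_measure (normal_prob 0 s) (B j) (mB j)).
pose c : {nonneg R} := NngNum (fine_ge0 q0).
have cE : c%:num%:E = q by rewrite /= fineK.
(* Independence as an identity of measures: under [P] restricted to [A], coordinate [i] has law N(0,
   s^2) scaled by [q]. *)
have kE C : measurable C -> pushforward (mrestr P mA) (niM i) C =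
    mscale c (normal_prob 0 s) C.
  move=> mC; rewrite /pushforward /mrestr /mscale AB noise_box; last exact: mupd.
  rewrite (bigD1 i)//= /upd eqxx muleC cE; congr (_ * _)%E.
  by apply: eq_bigr => j /negPf ->.
have -> : n @^-1` tuple_box B = niM i @^-1` (B i) `&` A.
  rewrite AB; congr (_ @^-1` tuple_box _); apply/funext => j.
  by rewrite /upd; case: eqP => // ->.
transitivity (\int[pushforward (mrestr P mA) (niM i)]_(y in B i) (density1 a y)%:E)%E.
  rewrite ge0_integral_pushforward//; last 2 first.
  - by apply/measurable_funTS/measurable_EFinP; exact: mdensity1.
  - by move=> y _; rewrite lee_fin expR_ge0.
  (* Restricting [P] to [A] amounts to giving it the indicator of [A] as density. *)
  rewrite (@ge0_integral_density _ _ R P (\1_A)) => //.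
  - rewrite integral_mkcondr; apply: eq_integral => x _.
    by rewrite epatch_indic shift_density_delta.
  - by move=> C mC; rewrite integral_indic// setIC.
  - apply: measurable_funTS; apply: measurableT_comp => //.
    by apply: measurableT_comp => //; exact: mdensity1.
  - by move=> x _; rewrite lee_fin expR_ge0.
  - exact: mB.
transitivity (\int[mscale c (normal_prob 0 s)]_(y in B i) (density1 a y)%:E)%E.
  by apply: eq_measure_integral => C mC _; exact: kE.
rewrite ge0_integral_mscale//; last 2 first.
- by apply/measurable_funTS/measurable_EFinP; exact: mdensity1.
- by move=> y _; rewrite lee_fin expR_ge0.
by rewrite cE integral_normal_prob_density// muleC.
exact: mB.
Qed.

(** Finite-dimensional Cameron-Martin formula. Quantifying over [f] inside the predicate lets the
    formulas for two shifts be composed, as composition changes the integrand. *)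
Definition translation_formula w := forall f : M.-tuple R -> \bar R,
  measurable_fun [set: M.-tuple R] f -> (forall v, 0 <= f v)%E ->
  (\int[P]_x f (tshift w (n x)) =
   \int[P]_x (f (n x) * (shift_density s w (n x))%:E))%E.

Let mdens w : measurable_fun [set: T] (fun x => shift_density s w (n x)).
Proof. by apply: measurableT_comp => //; exact: measurable_shift_density. Qed.

(** The law of the shifted noise under [P] and the law of the noise under the reweighted measure
    [nu] agree on boxes, hence on all measurable sets. *)
Lemma translation_formula_delta (a : R) i :
  translation_formula (a *: delta_mx i 0).
Proof.
move=> f mf f0; set w := a *: _.
have mwn : measurable_fun [set: T] (tshift w \o n).
  by apply: measurableT_comp => //; exact: measurable_tshift.
pose wnM : {mfun T >-> M.-tuple R} :=
  HB.pack (tshift w \o n) (isMeasurableFun.Build _ _ _ _ _ mwn).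
have [nu nuE] := density_measure P (mdens w) (fun x => shift_density_ge0 s w (n x)).
have lawE A : measurable A -> pushforward P wnM A = pushforward nu nM A.
  apply: (@eq_measure_tuple _ _ (pushforward P wnM) (pushforward nu nM)).
    by rewrite -[ltLHS]/(P setT) probability_setT ltry.
  move=> B mB.
  rewrite -[LHS]/(P ((tshift w \o n) @^-1` tuple_box B)).
  rewrite -[RHS]/(nu (n @^-1` tuple_box B)).
  rewrite nuE integral_noise_box_delta// shifted_noise_box//.
  have wi : w i 0 = a by rewrite !mxE !eqxx mulr1.
  have wj j : j != i -> w j 0 = 0 by move=> /negPf ji; rewrite !mxE ji mulr0.
  rewrite (bigD1 i isT) wi (eq_bigr (fun j => normal_prob 0 s (B j))).
    exact: erefl.
  by move=> j /wj ->.
transitivity (\int[pushforward P wnM]_v f v)%E.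
  by rewrite ge0_integral_pushforward.
rewrite (eq_measure_integral (pushforward nu nM)); last by move=> A mA _; exact: lawE.
rewrite ge0_integral_pushforward// preimage_setT.
rewrite (ge0_integral_density (mdens w)
  (fun x => shift_density_ge0 s w (n x)) (fun A _ => nuE A))//.
- exact: measurableT_comp.
- by move=> x _; exact: f0.
Qed.

(* The densities satisfy the cocycle identity [shift_densityD], so it suffices
   to translate one coordinate at a time. *)
Lemma translation_formulaD w1 w2 : translation_formula w1 ->
  translation_formula w2 -> translation_formula (w1 + w2).
Proof.
move=> H1 H2 f mf f0.
under eq_integral do rewrite tshiftD.
have mf1 := measurableT_comp mf (measurable_tshift w1).
rewrite (H2 (f \o tshift w1) mf1 (fun v => f0 (tshift w1 v))).
have tK v : tshift (- w1) (tshift w1 v) = v by rewrite -tshiftD addNr tshift0.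
have tNK v : tshift w1 (tshift (- w1) v) = v by rewrite -tshiftD subrr tshift0.
(* Applying [H2] leaves an integrand in both [tshift w1 (n x)] and [n x]; undoing the shift inside
   the density makes it a function of the shifted point alone, ready for [H1]. *)
pose F v := (f v * (shift_density s w2 (tshift (- w1) v))%:E)%E.
transitivity (\int[P]_x F (tshift w1 (n x)))%E.
  by apply: eq_integral => x _; rewrite /F tK.
rewrite H1; last 2 first.
- apply: emeasurable_funM => //; apply/measurable_EFinP.
  apply: measurableT_comp; first exact: measurable_shift_density.
  exact: measurable_tshift.
- by move=> v; rewrite mule_ge0// lee_fin shift_density_ge0.
apply: eq_integral => x _; rewrite /F -muleA -EFinM; congr (_ * _%:E)%E.
by rewrite mulrC -{1 3}(tNK (n x)) -shift_densityD.
Qed.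

Lemma gaussian_translation w : translation_formula w.
Proof.
rewrite [w]matrix_sum_delta.
apply: (big_ind translation_formula).
- move=> f mf f0; apply: eq_integral => x _.
  by rewrite tshift0 shift_density0 mule1.
- exact: translation_formulaD.
- by move=> i _; rewrite big_ord1; exact: translation_formula_delta.
Qed.

End gaussian_noise_translation.

(** * Means of square integrable functions of shifted noise *)

Section gaussian_mean.
Context (R : realType) (M : nat) (d : measure_display) (T : measurableType d).
Variables (P : probability T R) (s : R) (n : T -> M.-tuple R).
Hypotheses (s0 : s != 0) (gn : gaussian_noise P s n).

Let mn : measurable_fun [set: T] n. Proof. by case: gn. Qed.

Let mdens w : measurable_fun [set: T] (fun x => shift_density s w (n x)).
Proof. by apply: measurableT_comp => //; exact: measurable_shift_density. Qed.

(** The nonnegative formula applies to the positive and negative parts separately, and the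
    nonnegative density factors out of each. *)
Lemma integral_gaussian_translation w (f : M.-tuple R -> R) :
  measurable_fun [set: M.-tuple R] f ->
  (\int[P]_x (f (tshift w (n x)))%:E =
   \int[P]_x (f (n x) * shift_density s w (n x))%:E)%E.
Proof.
move=> mf; have mEf : measurable_fun [set: M.-tuple R] (EFin \o f).
  exact/measurable_EFinP.
rewrite integralE [RHS]integralE; congr (_ - _)%E.
- transitivity (\int[P]_x ((EFin \o f)^\+%E (tshift w (n x))))%E.
    by apply: eq_integral => x _; rewrite !funeposE.
  rewrite (gaussian_translation s0 gn w (measurable_funepos mEf)
    (fun v => funepos_ge0 _ v)).
  apply: eq_integral => x _; rewrite !funeposE/= -!EFin_max -EFinM.
  by rewrite maxr_pMl ?shift_density_ge0// mul0r.
- transitivity (\int[P]_x ((EFin \o f)^\-%E (tshift w (n x))))%E.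
    by apply: eq_integral => x _; rewrite !funenegE.
  rewrite (gaussian_translation s0 gn w (measurable_funeneg mEf)
    (fun v => funeneg_ge0 _ v)).
  apply: eq_integral => x _; rewrite !funenegE/= -!EFin_max -EFinM.
  by rewrite maxr_pMl ?shift_density_ge0// mul0r mulNr.
Qed.

Lemma integrable_gaussian_translation w (f : M.-tuple R -> R) :
  measurable_fun [set: M.-tuple R] f ->
  P.-integrable [set: T] (fun x => (f (n x) * shift_density s w (n x))%:E) ->
  P.-integrable [set: T] (fun x => (f (tshift w (n x)))%:E).
Proof.
move=> mf /integrableP[_ intf]; apply/integrableP; split.
  apply/measurable_EFinP; apply: measurableT_comp => //.
  by apply: measurableT_comp => //; exact: measurable_tshift.
rewrite (@gaussian_translation _ _ _ _ P s n s0 gn w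
  (fun v => `|(f v)%:E|%E)); first last.
- by move=> v; exact: abse_ge0.
- by apply: measurableT_comp => //; exact/measurable_EFinP.
- apply: le_lt_trans intf; rewrite le_eqVlt; apply/orP; left; apply/eqP.
  apply: eq_integral => x _.
  by rewrite abse_EFin -EFinM abse_EFin normrM (ger0_norm (shift_density_ge0 _ _ _)).
Qed.

Lemma shift_density_sqr w (v : M.-tuple R) :
  shift_density s w v ^+ 2 =
  expR (\sum_(i < M) w i 0 ^+ 2 / s ^+ 2) * shift_density s (w + w) v.
Proof.
rewrite expr2 /shift_density -!expRD -!big_split/=; congr expR.
apply: eq_bigr => i _; rewrite mxE -(mulr_natr (s ^+ 2)); field.
by [].
Qed.

(** By |a b| <= a^2 + b^2 it is enough that the squared density be integrable, and it is a constant
    times the density of the doubled shift. *)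
Lemma integrable_mul_shift_density w (f : M.-tuple R -> R) :
  measurable_fun [set: M.-tuple R] f ->
  P.-integrable [set: T] (fun x => (f (n x) ^+ 2)%:E) ->
  P.-integrable [set: T] (fun x => (f (n x) * shift_density s w (n x))%:E).
Proof.
move=> mf intf2.
have mfn : measurable_fun [set: T] (fun x => f (n x)) by exact: measurableT_comp.
(* The translation formula for the constant 1 gives the density total mass 1. *)
have intd : P.-integrable [set: T] (fun x => (shift_density s (w + w) (n x))%:E).
  apply/integrableP; split; first exact/measurable_EFinP.
  have := @gaussian_translation _ _ _ _ P s n s0 gn (w + w) (cst 1%E)
    (measurable_cst _) (fun=> lee01).
  rewrite [X in X = _ -> _](integral_cst P measurableT 1%E) mul1e.
  rewrite [X in X = _ -> _](probability_setT P) => E.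
  apply: (@le_lt_trans _ _ 1%E); last by rewrite ltry.
  rewrite le_eqVlt; apply/orP; left; apply/eqP; rewrite E.
  apply: eq_integral => x _; rewrite mul1e gee0_abs// lee_fin.
  exact: shift_density_ge0.
have intd2 : P.-integrable [set: T] (fun x => (shift_density s w (n x) ^+ 2)%:E).
  have := integrableZl measurableT (expR (\sum_(i < M) w i 0 ^+ 2 / s ^+ 2)) intd.
  by apply: eq_integrable => // x _; rewrite -EFinM shift_density_sqr.
apply: le_integrable (integrableD measurableT intf2 intd2) => //.
  by apply/measurable_EFinP; exact: measurable_funM.
move=> x _ /=; rewrite lee_fin [leRHS]ger0_norm ?addr_ge0 ?sqr_ge0//.
set a := f _; set b := shift_density _ _ _.
by rewrite ler_norml; apply/andP; split; nra.
Qed.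

Lemma gaussian_mean_eq0_line (f : M.-tuple R -> R) (a b : 'cV[R]_M) (e : R) :
  measurable_fun [set: M.-tuple R] f ->
  P.-integrable [set: T] (fun x => (f (n x) ^+ 2)%:E) -> 0 < e ->
  (forall t : R, 0 < t < e ->
    (\int[P]_x (f (tshift (a + t *: b) (n x)))%:E = 0)%E) ->
  forall t, (\int[P]_x (f (tshift (a + t *: b) (n x)))%:E = 0)%E.
Proof.
move=> mf intf2 e0 near0 t.
(* In the exponent of [shift_density s (a + u *: b)], the part linear in the noise splits between
   [W] (from [a]) and [u * Z] (from [b]); the positive factor [C u] removes the remaining |a + u
   b|^2 / (2 s^2). *)
pose W x := f (n x) * expR (\sum_(i < M) a i 0 * tnth (n x) i / s ^+ 2).
pose Z x := \sum_(i < M) b i 0 * tnth (n x) i / s ^+ 2.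
pose C u := expR (\sum_(i < M) (a + u *: b) i 0 ^+ 2 / (s ^+ 2 *+ 2)).
have mlin (c : 'cV[R]_M) :
    measurable_fun [set: T] (fun x => \sum_(i < M) c i 0 * tnth (n x) i / s ^+ 2).
  apply: measurable_sum => i; apply: measurable_funM => //.
  apply: measurable_funM => //; exact: (measurableT_comp (measurable_tnth i) mn).
have mW : measurable_fun [set: T] W.
  by apply: measurable_funM; exact: measurableT_comp.
have WZE u x :
    W x * expR (u * Z x) = C u * (f (n x) * shift_density s (a + u *: b) (n x)).
  rewrite /W /C mulrCA -mulrA -!expRD; congr (_ * expR _).
  rewrite /Z mulr_sumr -!big_split/=; apply: eq_bigr => i _; rewrite !mxE.
  by rewrite -(mulr_natr (s ^+ 2)); field.
have intd u := integrable_mul_shift_density (a + u *: b) mf intf2.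
have intWZ u : P.-integrable [set: T] (fun x => (W x * expR (u * Z x))%:E).
  have := integrableZl measurableT (C u) (intd u).
  by apply: eq_integrable => // x _; rewrite -EFinM WZE.
have intWZE u : (\int[P]_x (W x * expR (u * Z x))%:E =
    (C u)%:E * \int[P]_x (f (tshift (a + u *: b) (n x)))%:E)%E.
  rewrite integral_gaussian_translation// -integralZl//.
  by apply: eq_integral => x _; rewrite -EFinM WZE.
have := exponential_integral_eq0 mW (mlin b) intWZ e0 _ t.
rewrite intWZE => /(_ _)/eqP.
rewrite mule_eq0 eqe gt_eqF ?expR_gt0//= => E; apply/eqP; apply: E => u ue.
by rewrite intWZE near0// mule0.
Qed.

End gaussian_mean.

(** * Linear Gaussian model: from an open set of parameters to all of them *)

Lemma open_segment (R : realType) (N : nat) (U : set 'cV[R]_N)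
    (x1 v : 'cV[R]_N) : open U -> U x1 ->
  exists2 e : R, 0 < e & forall t : R, 0 < t < e -> U (x1 + t *: v).
Proof.
move=> oU Ux1.
have ct : (fun t : R => x1 + t *: v) @ (0 : R) --> x1 + (0 : R) *: v.
  by apply: cvgD; [exact: cvg_cst|apply: cvgZr_tmp; exact: cvg_id].
have : nbhs (x1 + (0 : R) *: v) U.
  by rewrite scale0r addr0; exact: open_nbhs_nbhs.
move=> /ct [e /= e0 eU]; exists e => // t /andP[t0 te]; apply: eU.
by rewrite /= sub0r normrN gtr0_norm.
Qed.

Section lgm.
Context (R : realType) (M N : nat) (H : 'M[R]_(M, N)) (k : 'I_N) (s : R).
Context (d : measure_display) (T : measurableType d) (P : probability T R).
Variable n : T -> M.-tuple R.
Hypotheses (s0 : s != 0) (gn : gaussian_noise P s n).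

Lemma lgm_obsE (x : 'cV[R]_N) v : lgm_obs H x v = tshift (H *m x) v.
Proof. by []. Qed.

Lemma lgm_obs_shift (x0 x : 'cV[R]_N) v :
  lgm_obs H x v = lgm_obs H x0 (tshift (H *m (x - x0)) v).
Proof. by rewrite !lgm_obsE -tshiftD -mulmxDr addrC subrK. Qed.

Lemma lgm_mean_eq0 (h : M.-tuple R -> R) (x0 : 'cV[R]_N) (U : set 'cV[R]_N) :
  measurable_fun [set: M.-tuple R] h ->
  P.-integrable [set: T] (fun w => (h (lgm_obs H x0 (n w)) ^+ 2)%:E) ->
  open U -> U !=set0 -> (forall x, U x -> lgm_mean H P n h x = 0%E) ->
  forall x, lgm_mean H P n h x = 0%E.
Proof.
move=> mh inth2 oU [x1 Ux1] hU x.
pose f v := h (lgm_obs H x0 v).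
have mf : measurable_fun [set: M.-tuple R] f.
  by apply: measurableT_comp => //; exact: (measurable_tshift (H *m x0)).
(* Observations being affine in the parameter, the line from [x1] through [x] becomes a line of
   noise shifts relative to [x0]; it reaches [x] at [t = 1]. *)
have meanE t : lgm_mean H P n h (x1 + t *: (x - x1)) =
    (\int[P]_w (f (tshift (H *m (x1 - x0) + t *: (H *m (x - x1))) (n w)))%:E)%E.
  apply: eq_integral => w _; rewrite (lgm_obs_shift x0) /f.
  by rewrite scalemxAr -mulmxDr addrAC.
have [e e0 eU] := open_segment (x - x1) oU Ux1.
have := meanE 1; rewrite scale1r addrC subrK => ->.
apply: (gaussian_mean_eq0_line s0 gn mf inth2 e0) => t te.
by rewrite -meanE; apply: hU; exact: eU.
Qed.

Lemma integrable_lgm (h : M.-tuple R -> R) (x0 x : 'cV[R]_N) :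
  measurable_fun [set: M.-tuple R] h ->
  P.-integrable [set: T] (fun w => (h (lgm_obs H x0 (n w)) ^+ 2)%:E) ->
  P.-integrable [set: T] (fun w => (h (lgm_obs H x (n w)))%:E).
Proof.
move=> mh inth2; pose f v := h (lgm_obs H x0 v).
have mf : measurable_fun [set: M.-tuple R] f.
  by apply: measurableT_comp => //; exact: (measurable_tshift (H *m x0)).
under eq_fun do rewrite (lgm_obs_shift x0).
apply: (integrable_gaussian_translation s0 gn mf).
exact: (integrable_mul_shift_density s0 gn _ mf inth2).
Qed.

(** The estimator [g0] carries the bias to the whole space: [g - g0] has mean zero on [U], hence
    everywhere, so [g] inherits the means of [g0]. *)
Lemma lgm_allowed_extend (X U : set 'cV[R]_N) (x0 : 'cV[R]_N)
    (c : 'cV[R]_N -> R) (g g0 : M.-tuple R -> R) :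
  open U -> U !=set0 -> U `<=` X -> X x0 ->
  lgm_allowed H k P n [set: 'cV[R]_N] c x0 g0 ->
  lgm_allowed H k P n X c x0 g ->
  lgm_allowed H k P n [set: 'cV[R]_N] c x0 g.
Proof.
move=> oU U0 UX Xx0 [mg0 intg0 varg0 meang0] [mg intg varg meang].
pose h v := g v - g0 v.
have mh : measurable_fun [set: M.-tuple R] h by exact: measurable_funB.
have mobs x : measurable_fun [set: T] (fun w => lgm_obs H x (n w)).
  have [mn _ _] := gn.
  exact: (measurableT_comp (measurable_tshift (H *m x)) mn).
(* The common mean of [g] and [g0] at [x0], a point of [X]; centring there turns finite variance
   into square integrability. *)
pose m := x0 k 0 + c x0.
have centered (f : M.-tuple R -> R) : measurable_fun [set: M.-tuple R] f ->
    (lgm_var H P n f x0 < +oo)%E -> lgm_mean H P n f x0 = m%:E ->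
    P.-integrable [set: T] (fun w => ((f (lgm_obs H x0 (n w)) - m) ^+ 2)%:E).
  move=> mf varf meanf; apply/integrableP; split.
    apply/measurable_EFinP; apply: measurable_funX; apply: measurable_funB => //.
    exact: measurableT_comp.
  apply: le_lt_trans varf; rewrite /lgm_var meanf/= le_eqVlt; apply/orP; left.
  by apply/eqP/eq_integral => w _; rewrite ger0_norm ?sqr_ge0.
have inth2 : P.-integrable [set: T] (fun w => (h (lgm_obs H x0 (n w)) ^+ 2)%:E).
  (* (a - b)^2 <= 2 (a - m)^2 + 2 (b - m)^2, the gap being (a + b - 2 m)^2. *)
  have := integrableZl measurableT 2 (integrableD measurableT
    (centered g mg varg (meang _ Xx0)) (centered g0 mg0 varg0 (meang0 _ I))).
  apply: le_integrable => //.
    by apply/measurable_EFinP; apply: measurable_funX; exact: measurableT_comp.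
  move=> w _ /=; rewrite lee_fin /h.
  set a := g _; set b := g0 _.
  rewrite ger0_norm ?sqr_ge0// (le_trans _ (ler_norm _))//.
  have := sqr_ge0 (a + b - 2 * m); nra.
have inth x := integrable_lgm x mh inth2.
(* Outside [X] the integrability of [g] comes from [g = h + g0]. *)
have intG x : P.-integrable [set: T] (fun w => (g (lgm_obs H x (n w)))%:E).
  have := integrableD measurableT (inth x) (intg0 x I).
  by apply: eq_integrable => // w _; rewrite /= -EFinD /h subrK.
have meanB x : lgm_mean H P n g x = (lgm_mean H P n h x + lgm_mean H P n g0 x)%E.
  rewrite /lgm_mean -integralD//; last exact: intg0.
  by apply: eq_integral => w _; rewrite -EFinD /h subrK.
have meanh : forall x, lgm_mean H P n h x = 0%E.
  apply: (lgm_mean_eq0 mh inth2 oU U0) => x Ux.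
  have := meanB x; rewrite meang ?meang0//; last exact: UX.
  have : lgm_mean H P n h x \is a fin_num by exact: integrable_fin_num.
  by case: (lgm_mean H P n h x) => // r _ [] E; congr EFin; lra.
split => //.
by move=> x _; rewrite meanB meanh add0e meang0.
Qed.

End lgm.

Unset Implicit Arguments.
Theorem theorem13 (R : realType) (M N : nat) (H : 'M[R]_(M, N)) (s : R)
  (k : 'I_N) (d : measure_display) (T : measurableType d)
  (P : probability T R) (n : T -> M.-tuple R) :
  0 < s -> gaussian_noise P s n ->
  forall (X : set 'cV[R]_N),
  (exists U : set 'cV[R]_N, [/\ open U, U !=set0 & U `<=` X]) ->
  forall (x0 : 'cV[R]_N) (c : 'cV[R]_N -> R),
  X x0 ->
  lgm_valid H k P n [set: 'cV[R]_N] c x0 ->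
  lgm_minvar H k P n X c x0 = lgm_minvar H k P n [set: 'cV[R]_N] c x0 /\
  (forall g : M.-tuple R -> R,
     lgm_LMV H k P n [set: 'cV[R]_N] c x0 g -> lgm_LMV H k P n X c x0 g).
Proof.
move=> s0 gn X [U [oU U0 UX]] x0 c Xx0 [g0 allowed0].
(* With the same allowed estimators on both sides, the infima and the estimators attaining them
   coincide. *)
have allowedE g : lgm_allowed H k P n X c x0 g <->
    lgm_allowed H k P n [set: 'cV[R]_N] c x0 g.
  split; last by move=> [mg intg varg meang]; split => // x _;
    [exact: intg|exact: meang].
  by apply: (lgm_allowed_extend (lt0r_neq0 s0) gn oU U0 UX Xx0 allowed0).
have minvarE : lgm_minvar H k P n X c x0 = lgm_minvar H k P n setT c x0.
  congr ereal_inf; apply/seteqP.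
  by split=> v [g [/allowedE ag ->]]; exists g.
split=> // g [ag vg]; split; first exact/allowedE.
by rewrite vg minvarE.
Qed.
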